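(* Fix positive integers $N$ and $t$, and a graph $H$ with $n$ vertices; write $K=K_t$. The minimum number of subgraphs isomorphic to $K_t$ among all $H$-covered graphs with $N$ vertices, denoted $\operatorname{cov}_{K_t}(N,H)$, is equal to the optimal value of the integer program $$\text{minimize } \sum_{k=1}^n a_K^H(k)\,x_k \quad\text{subject to}\quad \sum_{k=1}^n k x_k=N,\quad x_k\in\mathbb{Z}\ (1\le k\le n),\quad x_k\ge 0\ (1\le k\le n-1),\quad x_n\ge 1.$$ (If $N<n$, there are no $N$-vertex $H$-covered graphs and the program is infeasible; both minima are then taken to be $+\infty$.)
   Context: All graphs are finite and simple. A graph $G$ is $H$-covered if every vertex of $G$ lies in a (not necessarily induced) subgraph of $G$ isomorphic to $H$. For graphs $H,T$ and $A\subseteq V(H)$, $a_T^H(A)$ denotes the number of subgraphs of $H$ isomorphic to $T$ which have at least one vertex in $A$; $a_T^H(k)$ denotes the minimum of $a_T^H(A)$ over all $k$-vertex subsets $A\subseteq V(H)$. *)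

(* Defs.v *)
From HB Require Import structures.
From mathcomp Require Import all_boot all_order all_algebra.
From mathcomp Require Import constructive_ereal.

Set Implicit Arguments.
Unset Strict Implicit.
Unset Printing Implicit Defensive.

Import Order.TTheory GRing.Theory Num.Theory.

Local Open Scope nat_scope.

Record sgraph := SGraph {
  vertex :> finType;
  adj : rel vertex;
  adj_sym : symmetric adj;
  adj_irrefl : irreflexive adj }.

Definition edges (G : sgraph) : {set {set G}} :=
  [set e : {set G} | [exists u, exists v, adj u v && (e == [set u; v])]].

Lemma complete_sym (t : nat) : symmetric (fun i j : 'I_t => i != j).
Proof. by move=> i j; rewrite eq_sym. Qed.

Lemma complete_irrefl (t : nat) : irreflexive (fun i j : 'I_t => i != j).
Proof. by move=> i; rewrite eqxx. Qed.

Definition complete (t : nat) : sgraph :=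
  SGraph (@complete_sym t) (@complete_irrefl t).

(* A candidate subgraph of G is a pair (vertex set, edge set), so that two
   subgraphs on the same vertices with different edges are distinct. *)
Definition is_subgraph (G : sgraph) (S : {set G} * {set {set G}}) : bool :=
  (S.2 \subset edges G) && [forall e in S.2, e \subset S.1].

Definition sub_iso (T G : sgraph) (S : {set G} * {set {set G}}) : bool :=
  [exists f : {ffun T -> G},
    [&& injectiveb f,
        S.1 == [set f x | x : T]
      & S.2 == [set [set f x | x in (e : {set T})] | e in edges T]]].

Definition copies (T G : sgraph) : {set {set G} * {set {set G}}} :=
  [set S | is_subgraph S && sub_iso T S].

Definition covered (H G : sgraph) : Prop :=
  forall v : G, exists2 S, S \in copies H G & v \in S.1.

(* a_T^H(A) *)
Definition meet_copies (T H : sgraph) (A : {set H}) : nat :=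
  #|[set S in copies T H | S.1 :&: A != set0]|.

(* a_T^H(k), for k <= #|H|. The base value of the iterated minimum bounds every
   term from above, so it is irrelevant as soon as a k-subset exists: see
   [min_meet_copiesP]. *)
Definition min_meet_copies (T H : sgraph) (k : nat) : nat :=
  \big[minn/#|copies T H|]_(A : {set H} | #|A| == k) meet_copies T A.

Lemma min_meet_copiesP (T H : sgraph) (k : nat) : k <= #|H| ->
  (exists2 A : {set H}, #|A| = k & min_meet_copies T H k = meet_copies T A) /\
  (forall A : {set H}, #|A| = k -> min_meet_copies T H k <= meet_copies T A).
Proof.
move=> lekH.
have leP (A : {set H}) : #|A| = k -> min_meet_copies T H k <= meet_copies T A.
  move=> cA; rewrite /min_meet_copies.
  elim: (index_enum _) (mem_index_enum A) => // B s IHs.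
  rewrite inE big_cons => /predU1P[<-|/IHs le_s].
    by rewrite cA eqxx geq_minl.
  by case: ifP => // _; rewrite geq_min le_s orbT.
split=> //.
have [A0 cA0] : exists A : {set H}, #|A| = k.
  exists [set x in take k (enum H)].
  rewrite cardsE (card_uniqP _) ?take_uniq ?enum_uniq //.
  by rewrite size_takel // -cardE.
pose Q m := m = #|copies T H| \/
  exists2 A : {set H}, #|A| = k & m = meet_copies T A.
have: Q (min_meet_copies T H k).
  apply: (big_ind Q) => [|x y Qx Qy|A /eqP cA].
  - by left.
  - by rewrite /minn; case: ifP.
  - by right; exists A.
case=> // eqm; exists A0 => //; apply/eqP; rewrite eqn_leq leP //= eqm.
by apply/subset_leq_card/subsetP=> S; rewrite inE => /andP[].
Qed.

Local Open Scope ring_scope.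

(* [is_min S v]: v is the minimum of S, with value +oo on the empty set. *)
Definition is_min (S : int -> Prop) (v : \bar int) : Prop :=
  match v with
  | EFin m => S m /\ (forall s, S s -> m <= s)
  | EPInf => forall s, ~ S s
  | ENInf => False
  end.

Lemma is_min_unique (S : int -> Prop) (v w : \bar int) :
  is_min S v -> is_min S w -> v = w.
Proof.
case: v w => [m| |] [p| |] //=.
- by move=> [Sm lm] [Sp lp]; congr EFin; apply/le_anti; rewrite lm // lp.
- by move=> [Sm _] /(_ m).
- by move=> S0 [Sp _]; case: (S0 p).
Qed.

(* cov_T(N, H) = v *)
Definition is_cov (T : sgraph) (N : nat) (H : sgraph) (v : \bar int) : Prop :=
  is_min (fun m => exists G : sgraph,
    [/\ #|G| = N, covered H G & m = #|copies T G|%:Z]) v.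

Definition ip_feasible (n N : nat) (x : nat -> int) : Prop :=
  [/\ \sum_(1 <= k < n.+1) k%:Z * x k = N%:Z,
      forall k : nat, (1 <= k <= n.-1)%N -> 0 <= x k
    & 1 <= x n].

Definition ip_objective (a : nat -> nat) (n : nat) (x : nat -> int) : int :=
  \sum_(1 <= k < n.+1) (a k)%:Z * x k.

Definition is_ip_opt (a : nat -> nat) (n N : nat) (v : \bar int) : Prop :=
  is_min (fun m => exists2 x : nat -> int,
    ip_feasible n N x & m = ip_objective a n x) v.

(* Main.v *)
(* A copy of K_t is determined by its vertex set, so one counts t-cliques.
   Given an H-covered G, add copies of H one at a time, each reaching a vertex
   not seen before: a copy with k new vertices contributes at least a(k) cliques
   that are not contained in the vertices seen before, and the first copy has n
   new vertices. Conversely, starting from one copy H_0 of H, glue for each part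
   k of a feasible solution a new copy of H to H_0 along the identity outside an
   optimal k-set A: the cliques created are those of the new copy meeting A. *)
Require Import Defs.
From HB Require Import structures.
From mathcomp Require Import all_boot all_order all_algebra.
From mathcomp Require Import constructive_ereal.
From Stdlib Require Import Classical.

Set Implicit Arguments.
Unset Strict Implicit.
Unset Printing Implicit Defensive.

Import Order.TTheory GRing.Theory Num.Theory.

Local Open Scope nat_scope.

(** * Copies as images of embeddings, and copies of [complete t] as cliques *)

Definition is_clique (G : sgraph) (Q : {set G}) : bool :=
  [forall u in Q, forall v in Q, (u != v) ==> adj u v].

Lemma is_cliqueP (G : sgraph) (Q : {set G}) :
  reflect {in Q &, forall u v, u != v -> adj u v} (is_clique Q).
Proof.
apply: (iffP forall_inP) => [cQ u v uQ vQ uv|cQ u uQ].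
  by move/forall_inP: (cQ u uQ) => /(_ v vQ) /implyP; apply.
by apply/forall_inP => v vQ; apply/implyP; apply: cQ.
Qed.

Definition cliques (t : nat) (G : sgraph) : {set {set G}} :=
  [set Q : {set G} | (#|Q| == t) && is_clique Q].

Lemma mem_edges (G : sgraph) (u v : G) : ([set u; v] \in edges G) = adj u v.
Proof.
rewrite inE; apply/existsP/idP => [[a /existsP[b /andP[ab /eqP E]]]|uv]; last first.
  by exists u; apply/existsP; exists v; rewrite uv eqxx.
have ab_neq : a != b by apply: contraTneq ab => ->; rewrite adj_irrefl.
have /set2P[] : a \in [set u; v] by rewrite E set21.
  move=> au; have /set2P[] : b \in [set u; v] by rewrite E set22.
    by move=> bu; rewrite au bu eqxx in ab_neq.
  by move=> <-; rewrite -au.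
move=> av; have /set2P[] : b \in [set u; v] by rewrite E set22.
  by move=> <-; rewrite -av adj_sym.
by move=> bv; rewrite av bv eqxx in ab_neq.
Qed.

Lemma edgesP (G : sgraph) (e : {set G}) :
  reflect (exists u v, adj u v /\ e = [set u; v]) (e \in edges G).
Proof.
apply: (iffP idP) => [|[u [v [uv ->]]]]; last by rewrite mem_edges.
rewrite inE => /existsP[u /existsP[v /andP[uv /eqP ->]]].
by exists u, v.
Qed.

(** Only one implication, since copies of a graph need not be induced. *)
Definition hom (H G : sgraph) (f : H -> G) : Prop :=
  forall u v, adj u v -> adj (f u) (f v).

Definition hom_image (T G : sgraph) (f : T -> G) : {set G} * {set {set G}} :=
  ([set f x | x : T], [set [set f x | x in (e : {set T})] | e in edges T]).

Lemma copiesP (T G : sgraph) (S : {set G} * {set {set G}}) :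
  reflect (exists f : T -> G, [/\ injective f, hom f & S = hom_image f])
          (S \in copies T G).
Proof.
rewrite inE; apply: (iffP andP).
  case=> /andP[/subsetP sub _] /existsP[f /and3P[/injectiveP fI /eqP S1 /eqP S2]].
  exists f; split=> //; last by case: S S1 S2 {sub} => S1 S2 /= -> ->.
  move=> u v uv; rewrite -mem_edges; apply: sub; rewrite S2.
  apply/imsetP; exists [set u; v]; first by rewrite mem_edges.
  by rewrite imsetU !imset_set1.
case=> f [fI fH ->]; split.
  apply/andP; split.
    apply/subsetP => _ /imsetP[_ /edgesP[u [v [uv ->]]] ->].
    by rewrite imsetU !imset_set1 mem_edges; apply: fH.
  apply/forall_inP => _ /imsetP[e _ ->]; apply/subsetP => _ /imsetP[x _ ->].
  by rewrite imset_f.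
apply/existsP; exists (finfun f); apply/and3P; split.
- by apply/injectiveP => u v; rewrite !ffunE; apply: fI.
- by apply/eqP/eq_imset => x; rewrite ffunE.
- by apply/eqP/eq_imset => e; apply: eq_imset => x; rewrite ffunE.
Qed.

Lemma coveredP (H G : sgraph) :
  covered H G <->
  forall v : G, exists f : H -> G, [/\ injective f, hom f & exists x, v = f x].
Proof.
split=> cov v; case: (cov v).
  move=> _ /copiesP[f [fI fH ->]] /imsetP[x _ vE].
  by exists f; split=> //; exists x.
move=> f [fI fH [x vE]]; exists (hom_image f); first by apply/copiesP; exists f.
by rewrite vE imset_f.
Qed.

Lemma copies_complete_fst (t : nat) (G : sgraph) :
  [set S.1 | S in copies (complete t) G] = cliques t G.
Proof.
apply/setP => Q; rewrite inE; apply/imsetP/andP.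
  case=> _ /copiesP[f [fI fH ->]] ->; split.
    by rewrite card_imset // card_ord.
  apply/is_cliqueP => _ _ /imsetP[i _ ->] /imsetP[j _ ->] fij.
  by apply: fH => /=; apply: contraNneq fij => ->.
case=> /eqP cQ /is_cliqueP clQ; subst t.
exists (hom_image (fun i : complete #|Q| => enum_val i)).
  apply/copiesP; eexists; split; last by [].
    exact: enum_val_inj.
  move=> i j ij; apply: clQ; rewrite ?enum_valP //.
  by apply: contraNneq ij => /enum_val_inj ->.
apply/setP => x; apply/idP/imsetP => [xQ|[i _ ->]]; last exact: enum_valP.
by exists (enum_rank_in xQ x); rewrite ?enum_rankK_in.
Qed.

(** The edge set of such a copy is forced: it consists of all two-element subsets of the vertex
    set. *)
Lemma copies_complete_inj (t : nat) (G : sgraph) :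
  {in copies (complete t) G &, injective fst}.
Proof.
have pairs (f : complete t -> G) : injective f -> (hom_image f).2 =
    [set e : {set G} | (e \subset (hom_image f).1) && (#|e| == 2)].
  move=> fI; apply/setP => e; rewrite inE /=; apply/imsetP/andP.
    case=> e' /(@edgesP (complete t))[i [j [ij ->]]] ->; split.
      by apply/imsetS/subsetP.
    by rewrite card_imset // cards2 (ij : i != j).
  case=> /subsetP sub; case/cards2P => a [b [ab E]].
  have /sub/imsetP[i _ ai] : a \in e by rewrite E set21.
  have /sub/imsetP[j _ bj] : b \in e by rewrite E set22.
  exists [set i; j]; last by rewrite E imsetU !imset_set1 ai bj.
  by rewrite (@mem_edges (complete t)) /=; apply: contraNneq ab => ij; rewrite ai bj ij.
move=> _ _ /copiesP[f [fI _ ->]] /copiesP[g [gI _ ->]] E.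
by rewrite [hom_image f]surjective_pairing [hom_image g]surjective_pairing
           (pairs _ fI) (pairs _ gI) E.
Qed.

Lemma card_copies_complete (t : nat) (G : sgraph) :
  #|copies (complete t) G| = #|cliques t G|.
Proof.
by rewrite -copies_complete_fst card_in_imset //; apply: copies_complete_inj.
Qed.

Lemma meet_copies_complete (t : nat) (H : sgraph) (A : {set H}) :
  meet_copies (complete t) A = #|[set Q in cliques t H | Q :&: A != set0]|.
Proof.
rewrite /meet_copies -copies_complete_fst.
rewrite -(card_in_imset (f := fst)); last first.
  by move=> S S' /setIdP[cS _] /setIdP[cS' _]; apply: copies_complete_inj cS cS'.
apply: eq_card => Q; apply/imsetP/idP.
  by case=> S /setIdP[cS SA] ->; rewrite inE SA imset_f.
by case/setIdP => /imsetP[S cS ->] SA; exists S; rewrite // inE cS.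
Qed.

Lemma imset_clique (H G : sgraph) (f : H -> G) (t : nat) (Q : {set H}) :
  injective f -> hom f -> Q \in cliques t H -> f @: Q \in cliques t G.
Proof.
move=> fI fH; rewrite !inE card_imset // => /andP[-> /is_cliqueP cQ] /=.
apply/is_cliqueP => _ _ /imsetP[x xQ ->] /imsetP[y yQ ->] fxy.
by apply/fH/cQ => //; apply: contraNneq fxy => ->.
Qed.

(** * Lower bound: exhausting a covered graph by copies of [H] *)

(** With [U] the set of vertices reached so far, these are the cliques still to be accounted for. *)
Definition outer_cliques (t : nat) (G : sgraph) (U : {set G}) : {set {set G}} :=
  [set Q in cliques t G | ~~ (Q \subset U)].

(** Let [A] be the set of vertices of [H] that [f] sends outside [U]. A clique of [H] meeting [A]
    has an image that leaves [U] but stays inside [U :|: f @: setT]. These images are therefore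
    outer cliques for [U] and not for the larger set, and there are at least
    [min_meet_copies (complete t) H #|A|] of them. *)
Lemma outer_cliques_step (t : nat) (H G : sgraph) (f : H -> G) (U : {set G}) :
  injective f -> hom f ->
  min_meet_copies (complete t) H #|f @: setT :\: U|
    + #|outer_cliques t (U :|: f @: setT)| <= #|outer_cliques t U|.
Proof.
move=> fI fH; pose A := f @^-1: ~: U.
have cA : #|f @: setT :\: U| = #|A|.
  rewrite -(card_imset _ fI); apply: eq_card => x; rewrite inE.
  apply/andP/imsetP => [[xU /imsetP[y _ xy]]|[y]].
    by exists y; rewrite // !inE -xy.
  by rewrite !inE => yU ->; rewrite yU imset_f.
have [_ /(_ A erefl) leA] := min_meet_copiesP (complete t) (max_card (mem A)).
rewrite cA; apply: leq_trans (leq_add leA (leqnn _)) _.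
rewrite meet_copies_complete -(card_imset _ (imset_inj fI)).
set X := imset _ _; set Y := outer_cliques t _.
have XY : [disjoint X & Y].
  rewrite disjoint_subset; apply/subsetP => _ /imsetP[Q _ ->]; rewrite !inE.
  rewrite negb_and negbK orbC; apply/orP; left.
  by apply: subset_trans (subsetUr _ _); apply: imsetS; apply: subsetT.
have <- : #|X :|: Y| = #|X| + #|Y|.
  by apply/eqP; rewrite (leq_card_setU X Y).2.
apply/subset_leq_card; rewrite subUset; apply/andP; split; apply/subsetP => Q.
  case/imsetP => Q' /setIdP[cQ' /set0Pn[x /setIP[xQ xA]]] ->.
  rewrite inE imset_clique //=; apply/subsetPn; exists (f x); first exact: imset_f.
  by move: xA; rewrite !inE.
rewrite inE => /andP[cQ nQ]; rewrite inE cQ /=.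
by apply: contra nQ => QU; apply: subset_trans QU (subsetUl _ _).
Qed.

(** Induction on the number of vertices outside [U]: a copy through such a vertex [v] has a nonempty
    set [B] of new vertices. The entries of [ks] are the successive sizes of [B], and the bounds of
    [outer_cliques_step] telescope. *)
Lemma outer_cliques_seq (t : nat) (H G : sgraph) (U : {set G}) : covered H G ->
  exists ks : seq nat, [/\ all (fun k => 0 < k <= #|H|) ks,
    sumn ks = #|~: U| &
    \sum_(k <- ks) min_meet_copies (complete t) H k <= #|outer_cliques t U|].
Proof.
move/coveredP => cov; have [m] := ubnP #|~: U|; elim: m U => // m IHm U ltUm.
have [U0|/set0Pn[v vU]] := eqVneq (~: U) set0.
  by exists [::]; rewrite big_nil U0 cards0.
have [f [fI fH [x vE]]] := cov v.
set B := f @: setT :\: U.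
have UE : #|~: U| = #|B| + #|~: (U :|: f @: setT)|.
  rewrite -(cardsID (f @: setT) (~: U)); congr (_ + _); apply: eq_card => y.
    by rewrite !inE andbC.
  by rewrite !inE negb_or andbC.
have B0 : 0 < #|B|.
  apply/card_gt0P; exists v; rewrite inE vE imset_f // andbT -vE.
  by rewrite inE in vU.
have [|ks [kb ks_sum ks_le]] := IHm (U :|: f @: setT).
  by apply: leq_trans (ltUm : #|~: U| <= m); rewrite UE -add1n leq_add2r.
exists (#|B| :: ks); split.
- rewrite /= B0 kb andbT /=; apply: leq_trans (subset_leq_card (subsetDl _ _)) _.
  by rewrite card_imset // cardsT.
- by rewrite /= ks_sum -UE.
- rewrite big_cons; apply: leq_trans (outer_cliques_step t U fI fH).
  by rewrite leq_add2l.
Qed.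

Lemma covered_seq (t : nat) (H G : sgraph) : 0 < #|G| -> covered H G ->
  exists ks : seq nat, [/\ all (fun k => 0 < k <= #|H|) ks, 0 < #|H|,
    #|H| + sumn ks = #|G| &
    min_meet_copies (complete t) H #|H|
      + \sum_(k <- ks) min_meet_copies (complete t) H k <= #|copies (complete t) G|].
Proof.
move=> /card_gt0P[v _] cov; have [f [fI fH [x _]]] := (coveredP H G).1 cov v.
have cf : #|f @: setT| = #|H| by rewrite card_imset // cardsT.
have [ks [kb ks_sum ks_le]] := outer_cliques_seq t (f @: setT) cov.
exists ks; split=> //; first by apply/card_gt0P; exists x.
  by rewrite ks_sum -cf cardsC.
(* Starting from the empty set, all [#|H|] vertices of the first copy are new; this is the source of
   the constraint [1 <= x n]. *)
have := outer_cliques_step t set0 fI fH; rewrite setD0 set0U cf => le0.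
apply: leq_trans (leq_trans le0 _); first by rewrite leq_add2l.
rewrite card_copies_complete; apply/subset_leq_card/subsetP => Q.
by rewrite inE => /andP[].
Qed.

(** * Upper bound: gluing a new copy of [H] along the complement of [A] *)

Section Glue.
Variables (H G : sgraph) (g : H -> G) (A : {set H}).

Definition glue_vertex : finType := (G + {x : H | x \in A})%type.

(** A fresh vertex is joined to old vertices only inside [g @: ~: A], as [H] prescribes, so all its
    neighbours lie in the new copy. *)
Definition glue_adj (p q : glue_vertex) : bool :=
  match p, q with
  | inl u, inl v => adj u v
  | inr a, inr b => adj (val a) (val b)
  | inl u, inr a | inr a, inl u =>
      [exists w, [&& w \notin A, u == g w & adj w (val a)]]
  end.

Lemma glue_sym : symmetric glue_adj.
Proof. by move=> [u|a] [v|b] //=; rewrite adj_sym. Qed.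

Lemma glue_irrefl : irreflexive glue_adj.
Proof. by move=> [u|a] /=; rewrite adj_irrefl. Qed.

Definition glue : sgraph := SGraph glue_sym glue_irrefl.

Definition glue_copy (x : H) : glue :=
  if insub x is Some a then inr a else inl (g x).

Lemma glue_copyP (x : H) :
  (exists a : {x : H | x \in A}, val a = x /\ glue_copy x = inr a) \/
  (x \notin A /\ glue_copy x = inl (g x)).
Proof.
rewrite /glue_copy; case: insubP => [a _ ax|xA]; first by left; exists a.
by right.
Qed.

Hypothesis gI : injective g.
Hypothesis g_adj : forall u v, adj (g u) (g v) = adj u v.

Lemma glue_copy_inj : injective glue_copy.
Proof.
move=> x y.
case: (glue_copyP x) => [[a [<- ->]]|[_ ->]];
  case: (glue_copyP y) => [[b [<- ->]]|[_ ->]] //.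
  by case=> ->.
by case=> /gI.
Qed.

(** The new copy is induced: [g_adj] settles pairs of old vertices, and for mixed pairs injectivity
    of [g] identifies the witness [w] with the given vertex. *)
Lemma glue_copy_adj (x y : H) : adj (glue_copy x) (glue_copy y) = adj x y.
Proof.
have cross (a : {x : H | x \in A}) (z : H) : z \notin A ->
    [exists w, [&& w \notin A, g z == g w & adj w (val a)]] = adj z (val a).
  move=> zA; apply/existsP/idP => [[w /and3P[_ /eqP/gI -> //]]|za].
  by exists z; rewrite zA eqxx.
case: (glue_copyP x) => [[a [<- ->]]|[xA ->]];
  case: (glue_copyP y) => [[b [<- ->]]|[yA ->]] //=.
- by rewrite cross // adj_sym.
- by rewrite cross.
Qed.

Lemma card_glue : #|glue| = #|G| + #|A|.
Proof. by rewrite card_sum card_sig. Qed.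

Lemma glue_covered : covered H G -> covered H glue.
Proof.
move/coveredP => cov; apply/coveredP => -[u|a].
  have [f [fI fH [x ux]]] := cov u.
  exists (fun x => inl (f x)); split=> //; first by move=> y z [/fI].
  by exists x; rewrite ux.
exists glue_copy; split; first exact: glue_copy_inj.
  by move=> x y; rewrite glue_copy_adj.
exists (val a); case: (glue_copyP (val a)) => [[b [/val_inj -> ->]] //|[]].
by rewrite (valP a).
Qed.

(** A clique without fresh vertices is a clique of [G]. A clique with a fresh vertex lies wholly in
    the new copy, and as that copy is induced, the clique pulls back to one of [H] meeting [A]. *)
Lemma card_cliques_glue (t : nat) :
  #|cliques t glue| <= #|cliques t G| + meet_copies (complete t) A.
Proof.
have inlI : injective (inl : G -> glue) by move=> u v [].
rewrite meet_copies_complete -(card_imset _ (imset_inj inlI)).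
rewrite -(card_imset _ (imset_inj glue_copy_inj)).
apply: leq_trans (leq_card_setU _ _).1; apply/subset_leq_card/subsetP => Q.
rewrite inE => /andP[cQ /is_cliqueP clQ]; rewrite inE.
have [/existsP[a aQ]|nQ] := boolP [exists a, inr a \in Q].
  have aE : glue_copy (val a) = inr a.
    case: (glue_copyP (val a)) => [[b [/val_inj -> ->]] //|[]].
    by rewrite (valP a).
  have QE : glue_copy @: (glue_copy @^-1: Q) = Q.
    apply/setP => p; apply/imsetP/idP => [[x + ->]|pQ]; first by rewrite inE.
    suff [x px] : exists x, p = glue_copy x by exists x; rewrite // inE -px.
    case: p pQ => [u|b] pQ; last first.
      exists (val b); case: (glue_copyP (val b)) => [[c [/val_inj -> ->]] //|[]].
      by rewrite (valP b).
    (* An old vertex of [Q] is adjacent to the fresh vertex [a], hence is [g w] with [w] outside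
       [A]. *)
    have /existsP[w /and3P[wA /eqP -> _]] := clQ _ _ pQ aQ isT.
    exists w; case: (glue_copyP w) => [[c [cw _]]|[_ -> //]].
    by rewrite -cw (valP c) in wA.
  apply/orP; right; apply/imsetP; exists (glue_copy @^-1: Q) => //.
  rewrite !inE -(card_imset _ glue_copy_inj) QE cQ /=; apply/andP; split.
    apply/is_cliqueP => x y; rewrite !inE => xQ yQ xy.
    by rewrite -glue_copy_adj clQ // (inj_eq glue_copy_inj).
  by apply/set0Pn; exists (val a); rewrite !inE aE aQ (valP a).
have QE : inl @: [set u | inl u \in Q] = Q.
  apply/setP => -[u|a]; first by rewrite mem_imset // inE.
  have /existsPn/(_ a)/negPf -> := nQ.
  by apply/imsetP => -[].
apply/orP; left; apply/imsetP; exists [set u | inl u \in Q] => //.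
rewrite inE -(card_imset _ inlI) QE cQ /=.
by apply/is_cliqueP => u v; rewrite !inE => uQ vQ uv; apply: (clQ _ _ uQ vQ).
Qed.

End Glue.

Lemma seq_covered (t : nat) (H : sgraph) (ks : seq nat) :
  0 < t -> all (fun k => k <= #|H|) ks ->
  exists G : sgraph, [/\ #|G| = #|H| + sumn ks, covered H G &
    #|copies (complete t) G| <= min_meet_copies (complete t) H #|H|
      + \sum_(k <- ks) min_meet_copies (complete t) H k].
Proof.
move=> t0 kb.
(* The copy [g] must be induced for cliques inside a glued copy to come from [H]. *)
suff [G [g [gI gA cG cov le]]] : exists (G : sgraph) (g : H -> G),
    [/\ injective g, forall u v, adj (g u) (g v) = adj u v,
      #|G| = #|H| + sumn ks, covered H G &
      #|copies (complete t) G| <= min_meet_copies (complete t) H #|H|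
        + \sum_(k <- ks) min_meet_copies (complete t) H k].
  by exists G.
elim: ks kb => [_|k ks IHks /andP[kH /IHks[G [g [gI gA cG cov le]]]]].
  exists H, id; split=> //.
  - by rewrite addn0.
  - by apply/coveredP => v; exists id; split=> //; exists v.
  rewrite big_nil addn0.
  (* The only subset of full size is [setT], and [0 < t] makes every clique nonempty, so every
     clique meets it. *)
  have [[A cA ->] _] := min_meet_copiesP (complete t) (leqnn #|H|).
  have -> : A = setT by apply/eqP; rewrite eqEcard subsetT cardsT cA leqnn.
  rewrite card_copies_complete meet_copies_complete.
  apply/subset_leq_card/subsetP => Q QH; rewrite inE QH setIT -card_gt0.
  by move: QH; rewrite inE => /andP[/eqP ->].
have [[A cA aE] _] := min_meet_copiesP (complete t) kH.
(* The distinguished copy remains the initial one, now inside the left summand; every later gluing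
   uses it again. *)
exists (glue g A), (fun x => inl (g x)); split=> //.
- by move=> x y [/gI].
- by rewrite card_glue cG cA /= -addnA (addnC k).
- exact: glue_covered.
rewrite big_cons aE addnCA addnC card_copies_complete.
apply: leq_trans (card_cliques_glue A gI gA t) _.
by rewrite leq_add2r -card_copies_complete.
Qed.

(** * Lists of parts versus feasible solutions of the integer program *)

Local Open Scope ring_scope.

Lemma sum_count_mem (n : nat) (F : nat -> nat) (ks : seq nat) :
  all (fun k => 0 < k <= n)%N ks ->
  (\sum_(1 <= k < n.+1) F k * count_mem k ks = \sum_(k <- ks) F k)%N.
Proof.
elim: ks => [_|j ks IHks /= /andP[jb kb]].
  by rewrite big_nil big1 // => k _; rewrite muln0.
rewrite big_cons -IHks //; under eq_bigr => k _ do rewrite mulnDr.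
rewrite big_split /=; congr addn.
rewrite (bigD1_seq j) ?mem_index_iota ?iota_uniq //= eqxx muln1 big1 ?addn0 //.
by move=> k kj; rewrite eq_sym (negPf kj) muln0.
Qed.

Lemma ip_of_seq (a : nat -> nat) (n N : nat) (ks : seq nat) :
  (0 < n)%N -> all (fun k => 0 < k <= n)%N ks -> (n + sumn ks)%N = N ->
  exists2 x, ip_feasible n N x &
    ip_objective a n x = (a n + \sum_(k <- ks) a k)%N%:Z.
Proof.
(* Multiplicities, with the leading [n] standing for the first copy and giving [1 <= x n]. *)
move=> n0 kb <-; pose x k := (count_mem k (n :: ks))%:Z.
(* Used with [F := id] for the constraint and with [F := a] for the objective. *)
have xE (F : nat -> nat) :
    \sum_(1 <= k < n.+1) (F k)%:Z * x k = (F n + \sum_(k <- ks) F k)%N%:Z.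
  rewrite -(big_cons 0%N addn n ks xpredT F) -(@sum_count_mem n) /=; last first.
    by rewrite n0 leqnn.
  by rewrite (big_morph Posz PoszD erefl); apply: eq_bigr => k _; rewrite PoszM.
exists x; last exact: xE.
split=> //; first by rewrite (xE id) sumnE.
by rewrite /x /= eqxx.
Qed.

Lemma seq_of_ip (a : nat -> nat) (n N : nat) (x : nat -> int) :
  (0 < N)%N -> ip_feasible n N x ->
  exists ks, [/\ all (fun k => k <= n)%N ks, (n + sumn ks)%N = N &
    ip_objective a n x = (a n + \sum_(k <- ks) a k)%N%:Z].
Proof.
move=> N0 [xN xp xn].
(* For [n = 0] the constraint sum is empty, which contradicts [0 < N]. *)
have n0 : (0 < n)%N.
  by case: n xN {xp xn} => //; rewrite big_geq // => -[N00]; rewrite -N00 in N0.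
have xE k : (1 <= k < n.+1)%N -> x k = `|x k|%N%:Z.
  move=> /andP[k0 kn]; rewrite gez0_abs //.
  have [kn'|nk] := leqP k n.-1; first by rewrite xp // k0.
  have -> : k = n by apply/eqP; rewrite eqn_leq -ltnS kn -(prednK n0).
  exact: le_trans xn.
(* Each [k] is repeated [x k] times. Since [1 <= x n], one occurrence of [n] can be removed to serve
   as the initial copy. *)
pose s := flatten [seq nseq `|x k|%N k | k <- index_iota 1 n.+1].
have sE (F : nat -> nat) :
    \sum_(1 <= k < n.+1) (F k)%:Z * x k = (\sum_(k <- s) F k)%N%:Z.
  rewrite /s big_flatten big_map (big_morph Posz PoszD erefl).
  apply: eq_big_nat => k kb; rewrite big_nseq iter_addn_0.
  by rewrite {1}xE // PoszM.
have ns : n \in s.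
  apply/flatten_mapP; exists n; first by rewrite mem_index_iota n0 ltnS leqnn.
  by rewrite mem_nseq eqxx andbT absz_gt0; apply: contraTneq xn => ->.
exists (rem n s); split.
- apply/allP => k /mem_rem /flatten_mapP[j].
  by rewrite mem_index_iota mem_nseq => /andP[_ jn] /andP[_ /eqP ->].
- have [] : (\sum_(k <- s) k)%N%:Z = N%:Z by rewrite -(sE id).
  by rewrite (big_rem n) //= sumnE.
- by rewrite /ip_objective sE (big_rem n).
Qed.

(** * Equality of the two minima *)

(** Mutual domination makes both sets empty or gives them the same minimum. The minimum is first
    found in [C], whose elements are nonnegative, and then transferred to [I]. *)
Lemma common_is_min (C I : int -> Prop) :
  (forall m, C m -> 0 <= m) ->
  (forall m, C m -> exists2 p, I p & p <= m) ->
  (forall p, I p -> exists2 m, C m & m <= p) ->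
  exists v, is_min C v /\ is_min I v.
Proof.
move=> C0 CI IC; have [[m Cm]|nC] := classic (exists m, C m); last first.
  exists +oo%E; split=> s => [Cs|/IC[m Cm _]]; first by apply: nC; exists s.
  by apply: nC; exists m.
have [k kP] : exists k : nat, C k%:Z /\ forall m, C m -> k%:Z <= m.
  have := C0 _ Cm; case: m Cm => // m Cm _.
  (* Descent: either [m] is minimal or a smaller element of [C] takes its place. *)
  have [k] := ubnP m; elim: k m Cm => // k IHk m Cm mk.
  have [[p Cp pm]|nlt] := classic (exists2 p, C p & p < m%:Z).
    have := C0 _ Cp; case: p Cp pm => // p Cp pm _.
    by apply: (IHk p Cp); apply: leq_trans (mk : (m <= k)%N).
  exists m; split=> // p Cp; rewrite leNgt; apply/negP => pm; apply: nlt.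
  by exists p.
case: kP => Ck kmin; exists k%:Z%:E; split; first by [].
have Imin p : I p -> k%:Z <= p.
  by move=> /IC[m' Cm' m'p]; apply: le_trans m'p; apply: kmin.
split=> //; have [p Ip pk] := CI _ Ck.
by have -> : k%:Z = p by apply/le_anti; rewrite pk Imin.
Qed.

Theorem theorem1p4 (N t n : nat) (H : sgraph)
    (N_gt0 : (0 < N)%N) (t_gt0 : (0 < t)%N) (cardH : #|H| = n) :
  exists v : \bar int,
    [/\ is_cov (complete t) N H v,
        is_ip_opt (min_meet_copies (complete t) H) n N v
      & (N < n)%N -> v = +oo%E].
Proof.
have [||| v [covv optv]] := @common_is_min
  (fun m => exists G : sgraph,
    [/\ #|G| = N, covered H G & m = #|copies (complete t) G|%:Z])
  (fun m => exists2 x : nat -> int, ip_feasible n N x &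
    m = ip_objective (min_meet_copies (complete t) H) n x).
- by move=> _ [G [_ _ ->]].
- move=> _ [G [cG cov ->]].
  have [|ks [kb H0 cN le]] := covered_seq t _ cov; first by rewrite cG.
  rewrite cardH cG in kb H0 cN le.
  have [x fx ox] := ip_of_seq (min_meet_copies (complete t) H) H0 kb cN.
  by exists (ip_objective (min_meet_copies (complete t) H) n x);
    [exists x | rewrite ox].
- move=> _ [x fx ->].
  have [ks [kb cN ->]] := seq_of_ip (min_meet_copies (complete t) H) N_gt0 fx.
  rewrite -cardH in kb.
  have [G [cG cov le]] := seq_covered t_gt0 kb.
  exists #|copies (complete t) G|%:Z; last by rewrite -cardH.
  by exists G; rewrite cG cardH cN.
exists v; split=> // Nn; move: optv {covv}; case: v => [m [[x fx _] _]| |] //.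
(* Zero coefficients suffice here: only the equation [n + sumn ks = N] is wanted, and it contradicts
   [N < n]. *)
have [ks [_ cN _]] := seq_of_ip (fun=> 0%N) N_gt0 fx.
by move: Nn; rewrite -cN ltnNge leq_addr.
Qed.
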